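(* In the setting described in the context, with everything except the regularization parameter $\gamma>0$ fixed, let $\breve\lambda=\min_{i=1,\dots,E}\lambda_i$. (a) Consider the estimated overall error $\|f_z-f_\rho\|_{\mathscr{L}^2_{\rho_{\mathscr X}}}$ obtained by summing the sample error bound and the first approximation error bound, $$F_{(a)}(\gamma)=\frac{C_{\mathscr K}^3}{\gamma}\sqrt{\frac{B_f^2+B_\sigma^2}{\breve\lambda N\delta}}+\frac{\gamma}{\breve\lambda+\gamma}\|\bar\alpha^\pi\|_2+\sqrt{\sum_{q\in\mathbb N\setminus Q}\bar\alpha_q^2},\qquad \gamma>0.$$ If the number of data $N$ and the confidence parameter $\delta$ are such that $$\sqrt{N\delta}>\frac{C_{\mathscr K}^3}{\breve\lambda^{3/2}}\sqrt{\frac{B_f^2+B_\sigma^2}{\sum_{i=1}^E(\bar\alpha_i^\pi)^2}},$$ then there exists a unique $\gamma=\hat\gamma_{(a)}$ minimizing the estimated error $F_{(a)}$ over $\gamma>0$. (b) Consider the estimated overall error $\|f_z-f_\rho\|_{\mathscr{L}^2_{\rho_{\mathscr X}}}$ obtained by summing the sample error bound and the second approximation error bound, $$F_{(b)}(\gamma)=\frac{C_{\mathscr K}^3}{\gamma}\sqrt{\frac{B_f^2+B_\sigma^2}{\breve\lambda N\delta}}+\|\bar\alpha^\pi\|_\infty\,\gamma\sum_{i=1}^E\frac1{\lambda_i}+\sqrt{\sum_{q\in\mathbb N\setminus Q}\bar\alpha_q^2},\qquad \gamma>0.$$ Then there always exists a unique $\gamma=\hat\gamma_{(b)}$ minimizing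 the estimated error $F_{(b)}$ over $\gamma>0$.
   Context: Input/output spaces and measure. Let $X>0$, $\mathscr X=[-X/2,X/2]\subset\mathbb R$, $\mathscr Y=\mathbb R$, $\mathscr Z=\mathscr X\times\mathscr Y$. Let $\rho$ be a probability measure on $\mathscr Z$ whose marginal $\rho_{\mathscr X}$ on $\mathscr X$ is uniform, $d\rho_{\mathscr X}(x)=d\mu(x)/X$ with $\mu$ the Lebesgue measure, and with conditional distributions $\rho(y|x)$ on $\mathbb R$. The regression function is $f_\rho(x)=\int_{\mathscr Y}y\,d\rho(y|x)$. The space $\mathscr{L}^2_{\rho_{\mathscr X}}$ is the space of square-integrable functions on $\mathscr X$ with norm $\|f\|_{\mathscr{L}^2_{\rho_{\mathscr X}}}=\big(\int_{\mathscr X}f(x)^2\,d\rho_{\mathscr X}(x)\big)^{1/2}$. It is assumed that $f_\rho\in\mathscr{L}^2_{\rho_{\mathscr X}}$ with $\|f_\rho\|_{\mathscr{L}^2_{\rho_{\mathscr X}}}\le B_f$, and that $\int_{\mathscr Z}(y-f_\rho(x))^2\,d\rho(x,y)\le B_\sigma^2$, for constants $B_f,B_\sigma$. The data are $N$ independent samples $(x_t,y_t)$, $t=1,\dots,N$, drawn from $\rho$, and $\delta\in(0,1)$ is a confidence parameter. Trigonometric expansion. $\mathbb N=\{1,2,\dots\}$. For $q\in\mathbb N$ put $\bar\varphi^s_q(x)=\sqrt2\sin(2\pi qx/X)$ and $\bar\varphi^c_q(x)=\sqrt2\cos(2\pi qx/X)$. The regression function is represented as $f_\rho=\sum_{q\in\mathbb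 N}(\bar\alpha^s_q\bar\varphi^s_q+\bar\alpha^c_q\bar\varphi^c_q)$ with square-summable real coefficients. In compact notation, $\bar\alpha_q^2$ in a sum over $q$ stands for $(\bar\alpha_q^s)^2+(\bar\alpha_q^c)^2$. Hypothesis space. Let $E$ be a positive even integer, $Q=\{q_1,\dots,q_{E/2}\}\subset\mathbb N$ a set of $E/2$ distinct frequencies, and for $j=1,\dots,E/2$ set $\varphi_j=\bar\varphi^s_{q_j}$, $\varphi_{j+E/2}=\bar\varphi^c_{q_j}$. The vector $\bar\alpha^\pi\in\mathbb R^E$ is given by $\bar\alpha^\pi_j=\bar\alpha^s_{q_j}$ and $\bar\alpha^\pi_{j+E/2}=\bar\alpha^c_{q_j}$ for $j=1,\dots,E/2$; $\|\cdot\|_2$ and $\|\cdot\|_\infty$ are the Euclidean and maximum norms on $\mathbb R^E$. Let $\phi(x)=[\varphi_1(x),\dots,\varphi_E(x)]^\top$ and $\Sigma_\alpha=\mathrm{diag}(\lambda_1,\dots,\lambda_E)$ with all $\lambda_i>0$. The kernel is $\mathscr K(x_a,x_b)=\phi(x_a)^\top\Sigma_\alpha\phi(x_b)$, and $C_{\mathscr K}=\sup_{x_a,x_b\in\mathscr X}\sqrt{|\mathscr K(x_a,x_b)|}$. Its reproducing kernel Hilbert space is $\mathscr H=\{\phi^\top(\cdot)\alpha:\alpha\in\mathbb R^E\}$ with $\|\phi^\top(\cdot)\alpha\|_{\mathscr H}^2=\alpha^\top\Sigma_\alpha^{-1}\alpha$. Estimator. For $\gamma>0$, $f_z=\arg\min_{f\in\mathscr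 H}\frac1N\sum_{t=1}^N(y_t-f(x_t))^2+\gamma\|f\|_{\mathscr H}^2$, and its data-free limit is $f_{\mathscr H}=\arg\min_{f\in\mathscr H}\int_{\mathscr X}(f(x)-f_\rho(x))^2\,d\rho_{\mathscr X}(x)+\gamma\|f\|_{\mathscr H}^2$. The first term of $F_{(a)}$ and of $F_{(b)}$ is the bound on the sample error $\|f_z-f_{\mathscr H}\|_{\mathscr{L}^2_{\rho_{\mathscr X}}}$ (stated with confidence at least $1-\delta$); the remaining terms are two alternative bounds on the approximation error $\|f_{\mathscr H}-f_\rho\|_{\mathscr{L}^2_{\rho_{\mathscr X}}}$. ''Estimated error $\|f_z-f_\rho\|_{\mathscr{L}^2_{\rho_{\mathscr X}}}$'' means the sum of these bounds, viewed as a function of $\gamma$.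
   Formalization: The formal theorem assumes that the coefficient vector ᾱ^π is nonzero: the condition in (a) divides by its squared norm, and (b) fails without it, since F_(b)(γ) is then c/γ plus a constant, which has no unique minimizer over γ>0. *)

(* Defs.v *)
From HB Require Import structures.
From mathcomp Require Export all_boot all_order all_algebra.
From mathcomp Require Export all_classical all_reals all_analysis.

Set Implicit Arguments.
Unset Strict Implicit.
Unset Printing Implicit Defensive.

Import Order.TTheory GRing.Theory Num.Theory.
Import numFieldNormedType.Exports.

Local Open Scope classical_set_scope.
Local Open Scope ring_scope.

Section data_distribution.
Context {R : realType}.
Local Notation TR := (measurableTypeR R).

Definition input_space (X : R) : set R := `[- X / 2, X / 2].

Lemma input_space_lt (X : R) : 0 < X -> - X / 2 < X / 2.
Proof.
by move=> X0; rewrite ltr_pM2r ?invr_gt0// (lt_trans _ X0)// oppr_lt0.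
Qed.

Definition rhoX (X : R) (X0 : 0 < X) : probability TR R :=
  uniform_prob (input_space_lt X0).

(* rho lives on R * R: a first marginal equal to rhoX makes it concentrated on
   input_space X * R, and values of k outside input_space X are irrelevant. *)
Definition has_input_marginal (rho : probability (TR * TR)%type R)
    (nu : probability TR R) : Prop :=
  forall A, measurable A -> rho (A `*` [set: TR]) = nu A.

Definition has_conditional (rho : probability (TR * TR)%type R)
    (nu : probability TR R) (k : R.-pker TR ~> TR) : Prop :=
  forall A B, measurable A -> measurable B ->
    rho (A `*` B) = (\int[nu]_(x in A) k x B)%E.

Definition regression (k : R.-pker TR ~> TR) (x : TR) : R := \int[k x]_y y.

Local Open Scope ereal_scope.

(* The product rule, for all measurable rectangles, says at once that the
   samples are mutually independent and that each has law rho (take all other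
   A t full). *)
Definition iid_samples d (Omega : measurableType d) (P : probability Omega R)
    (N : nat) (rho : probability (TR * TR)%type R)
    (z : 'I_N -> {RV P >-> (TR * TR)%type}) : Prop :=
  forall A : 'I_N -> set (TR * TR)%type, (forall t, measurable (A t)) ->
    P (\bigcap_t (z t @^-1` A t)) = \prod_(t < N) rho (A t).

End data_distribution.

Section trigonometric_kernel.
Context {R : realType}.
Local Notation TR := (measurableTypeR R).

Definition phis (X : R) (q : nat) (x : R) : R :=
  Num.sqrt 2 * sin (2 * pi * q%:R * x / X).
Definition phic (X : R) (q : nat) (x : R) : R :=
  Num.sqrt 2 * cos (2 * pi * q%:R * x / X).

Definition trig_sum (X : R) (als alc : nat -> R) (n : nat) (x : R) : R :=
  \sum_(1 <= q < n) (als q * phis X q x + alc q * phic X q x).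

(* The expansion f = \sum_(q >= 1) (als q * phis q + alc q * phic q) is
   convergence of the partial sums in the L2 norm. *)
Definition trig_expansion (X : R) (X0 : 0 < X) (als alc : nat -> R)
    (f : TR -> R) : Prop :=
  (fun n => 'N[rhoX X0]_2%:E[EFin \o
     (fun x => f x - trig_sum X als alc n x)%R])%E @ \oo --> 0%E.

Definition square_summable (a : nat -> R) : Prop :=
  cvgn (fun n => \sum_(1 <= q < n) a q ^+ 2).

(* E / 2 = m.+1, so that E ranges over the positive even integers
   m.+1 + m.+1; the sine block comes first. *)
Variable m : nat.
Local Notation E := (m.+1 + m.+1)%N.

Definition feature (X : R) (freq : 'I_m.+1 -> nat) (x : R) : 'cV[R]_E :=
  col_mx (\col_j phis X (freq j) x) (\col_j phic X (freq j) x).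

Definition alpha_pi (freq : 'I_m.+1 -> nat) (als alc : nat -> R) : 'cV[R]_E :=
  col_mx (\col_j als (freq j)) (\col_j alc (freq j)).

Definition kernel_K (X : R) (freq : 'I_m.+1 -> nat) (lam : 'rV[R]_E)
    (xa xb : R) : R :=
  ((feature X freq xa)^T *m diag_mx lam *m feature X freq xb) 0 0.

Definition kernel_sup (X : R) (freq : 'I_m.+1 -> nat) (lam : 'rV[R]_E) : R :=
  sup [set Num.sqrt `|kernel_K X freq lam xa xb|
      | xa in input_space X & xb in input_space X].

Definition lam_min (lam : 'rV[R]_E) : R :=
  \big[Num.min/lam 0 (lshift m.+1 ord0)]_(i < E) lam 0 i.

Definition norm2 (v : 'cV[R]_E) : R := Num.sqrt (\sum_(i < E) v i 0 ^+ 2).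

Definition tail_sum (freq : 'I_m.+1 -> nat) (als alc : nat -> R) : R :=
  limn (fun n => \sum_(1 <= q < n | q \notin codom freq)
                   (als q ^+ 2 + alc q ^+ 2)).

End trigonometric_kernel.

Section estimated_errors.
Context {R : realType} (m : nat).
Local Notation E := (m.+1 + m.+1)%N.
Variables (X : R) (freq : 'I_m.+1 -> nat) (lam : 'rV[R]_E).
Variables (als alc : nat -> R) (Bf Bs : R) (N : nat) (delta : R).

Definition sample_error_bound (gamma : R) : R :=
  kernel_sup X freq lam ^+ 3 / gamma *
  Num.sqrt ((Bf ^+ 2 + Bs ^+ 2) / (lam_min lam * N%:R * delta)).

Definition approx_error_bound_a (gamma : R) : R :=
  gamma / (lam_min lam + gamma) * norm2 (alpha_pi freq als alc) +
  Num.sqrt (tail_sum freq als alc).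

Definition approx_error_bound_b (gamma : R) : R :=
  mx_norm (alpha_pi freq als alc) * gamma * (\sum_(i < E) (lam 0 i)^-1) +
  Num.sqrt (tail_sum freq als alc).

Definition F_a (gamma : R) : R :=
  sample_error_bound gamma + approx_error_bound_a gamma.

Definition F_b (gamma : R) : R :=
  sample_error_bound gamma + approx_error_bound_b gamma.

End estimated_errors.

Definition minimizes_over_pos {R : realType} (F : R -> R) (gamma : R) : Prop :=
  0 < gamma /\ forall gamma', 0 < gamma' -> F gamma <= F gamma'.

(* Main.v *)
Require Import Defs.
From mathcomp Require Import all_boot all_order all_algebra.
From mathcomp Require Import all_classical all_reals all_analysis.
From mathcomp Require Import measurable_realfun ring lra.

Set Implicit Arguments.
Unset Strict Implicit.
Unset Printing Implicit Defensive.

Import Order.TTheory GRing.Theory Num.Theory.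
Import numFieldNormedType.Exports.

Local Open Scope classical_set_scope.
Local Open Scope ring_scope.

(** Both estimated errors have the form of a decreasing hyperbola [A / g], with
    [A] the constant of the sample error, plus an increasing approximation
    error, and in both cases the completed square gives more than calculus
    would: up to a constant the error is a square [(s - t * g) ^+ 2] divided by
    a positive weight, so its minimum over [g > 0] is attained at [s / t] and
    nowhere else ([unique_minimizer_of_square]).  For (a) the saturating term
    [g / (l + g) * n] only increases by [n] in total, and the square has a
    positive root exactly when [A < n * l]
    ([unique_minimizer_inv_plus_saturating]); this is the assumption on
    [N * delta] solved for [A] ([sample_constant_lt]).  For (b) the term
    [M * g] is unbounded and [0 < A], [0 < M] suffice
    ([unique_minimizer_inv_plus_linear]).

    The analytic content is that [A] is positive, for otherwise the infimum
    would be approached as [g] tends to 0 and never attained.  This requires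
    two facts.  The supremum of the kernel is positive, as the cosine features
    do not vanish at 0 ([kernel_sup_gt0]).  And [Bf] is positive: it bounds the
    L2 norm of the regression function, which bounds each of the trigonometric
    coefficients ([normr_coef_le_Lnorm2]), and one of these is nonzero because
    [alpha_pi] is.  The bound on the coefficients is Bessel's inequality for
    one coefficient, passed to the limit of the partial sums; it rests on the
    orthogonality of sines and cosines over a period ([Rintegral_waveM]). *)

(** * Minimizers by completing the square *)

Lemma unique_minimizer_of_square (R : realType) (F w : R -> R) (v s t : R) :
  0 < s -> 0 < t -> (forall g, 0 < g -> 0 < w g) ->
  (forall g, 0 < g -> F g = v + (s - t * g) ^+ 2 / w g) ->
  exists! g, minimizes_over_pos F g.
Proof.
move=> s0 t0 w0 FE.
have g0 : 0 < s / t by rewrite divr_gt0.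
have Fg : F (s / t) = v.
  by rewrite FE// mulrCA divff ?gt_eqF// mulr1 subrr expr0n/= mul0r addr0.
exists (s / t); split.
  split=> // g' g'0; rewrite Fg FE// lerDl divr_ge0 ?sqr_ge0// ltW//.
  exact: w0.
move=> g' [g'0 /(_ _ g0)]; rewrite Fg FE// gerDl.
rewrite pmulr_lle0 ?invr_gt0 ?w0// => sq0.
have /eqP : (s - t * g') ^+ 2 = 0 by apply/le_anti; rewrite sq0 sqr_ge0.
rewrite sqrf_eq0 subr_eq0 => /eqP ->.
by rewrite mulrC mulrA mulVf ?mul1r// gt_eqF.
Qed.

(** With [s = sqrt A] and [t = sqrt (n * l)], the saturating term is
    [t ^+ 2 / l - t ^+ 2 / (l + g)], and the sum differs from
    [c + (t ^+ 2 - (t - s) ^+ 2) / l] by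
    [(s * l - (t - s) * g) ^+ 2 / (l * g * (l + g))].  The condition [A < n * l]
    is [s < t], that is, the root of the square is positive. *)
Lemma unique_minimizer_inv_plus_saturating (R : realType) (A n l c : R) :
  0 < l -> 0 < A < n * l ->
  exists! g, minimizes_over_pos (fun g => A / g + (g / (l + g) * n + c)) g.
Proof.
move=> l0 /andP[A0 Anl].
have nl0 : 0 < n * l by exact: lt_trans Anl.
set s := Num.sqrt A; set t := Num.sqrt (n * l).
have s0 : 0 < s by rewrite sqrtr_gt0.
have st : 0 < t - s by rewrite subr_gt0 ltr_sqrt.
have As : A = s ^+ 2 by rewrite sqr_sqrtr// ltW.
have nt : n = t ^+ 2 / l by rewrite sqr_sqrtr ?mulfK ?gt_eqF// ltW.
apply: (@unique_minimizer_of_square _ _ (fun g => l * g * (l + g))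
  (c + (t ^+ 2 - (t - s) ^+ 2) / l) (s * l) (t - s)) => //.
- by rewrite mulr_gt0.
- by move=> g g0; rewrite !mulr_gt0// addr_gt0.
- move=> g g0; rewrite As nt; field.
  by rewrite !gt_eqF// addr_gt0.
Qed.

(** The arithmetic-geometric mean inequality: the sum exceeds
    [c + 2 * sqrt (A * M)] by [(sqrt A - sqrt M * g) ^+ 2 / g]. *)
Lemma unique_minimizer_inv_plus_linear (R : realType) (A M c : R) :
  0 < A -> 0 < M ->
  exists! g, minimizes_over_pos (fun g => A / g + (M * g + c)) g.
Proof.
move=> A0 M0.
set s := Num.sqrt A; set t := Num.sqrt M.
have As : A = s ^+ 2 by rewrite sqr_sqrtr// ltW.
have Mt : M = t ^+ 2 by rewrite sqr_sqrtr// ltW.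
apply: (@unique_minimizer_of_square _ _ id (c + s * t *+ 2) s t) => //.
- by rewrite sqrtr_gt0.
- by rewrite sqrtr_gt0.
- by move=> g g0; rewrite As Mt; field; rewrite gt_eqF.
Qed.

(** The lower bound on the amount of data [D = N * delta] is the condition for
    a positive minimizer in (a), with the unknown [D] isolated. *)
Lemma sample_constant_lt (R : realType) (K B l S D : R) :
  0 < B -> 0 < l -> 0 < S -> 0 < D ->
  K / l `^ (3 / 2) * Num.sqrt (B / S) < Num.sqrt D ->
  K * Num.sqrt (B / (l * D)) < Num.sqrt S * l.
Proof.
move=> B0 l0 S0 D0 hD.
have q0 : 0 < Num.sqrt D by rewrite sqrtr_gt0.
have -> : K * Num.sqrt (B / (l * D)) =
    K / l `^ (3 / 2) * Num.sqrt (B / S) * (Num.sqrt S * l / Num.sqrt D).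
  have -> : l `^ (3 / 2) = l * Num.sqrt l.
    have -> : 3 / 2 = 1 + 2^-1 :> R by field.
    by rewrite powRD ?gt_eqF ?implybT// powRr1 ?ltW// powR12_sqrt// ltW.
  have -> : Num.sqrt (B / S) = Num.sqrt B / Num.sqrt S.
    by rewrite sqrtrM ?(ltW B0)// sqrtrV// ltW.
  rewrite sqrtrM ?(ltW B0)// sqrtrV; last by exact/ltW/mulr_gt0.
  rewrite sqrtrM ?(ltW l0)//.
  by field; rewrite !gt_eqF// sqrtr_gt0.
have nl0 : 0 < Num.sqrt S * l by rewrite mulr_gt0// sqrtr_gt0.
by rewrite mulrCA gtr_pMr// ltr_pdivrMr// mul1r.
Qed.

(** * Positivity of the kernel supremum *)

Section kernel.
Context {R : realType} (m : nat).
Variables (X : R) (freq : 'I_m.+1 -> nat) (lam : 'rV[R]_(m.+1 + m.+1)).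
Hypothesis lam_gt0 : forall i, 0 < lam 0 i.

Lemma lam_min_gt0 : 0 < lam_min lam.
Proof.
rewrite /lam_min; elim/big_ind: _ => // x y x0 y0.
by rewrite lt_min x0.
Qed.

Lemma kernel_KE (xa xb : R) : kernel_K X freq lam xa xb =
  \sum_i feature X freq xa i 0 * lam 0 i * feature X freq xb i 0.
Proof.
rewrite /kernel_K mxE; apply: eq_bigr => i _.
by rewrite mul_mx_diag !mxE.
Qed.

Lemma normr_feature_le (x : R) i : `|feature X freq x i 0| <= Num.sqrt 2.
Proof.
rewrite /feature mxE; case: splitP => j _; rewrite mxE.
- by rewrite /phis normrM ger0_norm ?sqrtr_ge0// ler_piMr ?sqrtr_ge0// sin_max.
- by rewrite /phic normrM ger0_norm ?sqrtr_ge0// ler_piMr ?sqrtr_ge0// cos_max.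
Qed.

(** The supremum of an unbounded set is 0 by convention, so that a bound is
    needed for [kernel_sup] to dominate the values of the kernel. *)
Lemma normr_kernel_le (xa xb : R) :
  `|kernel_K X freq lam xa xb| <= \sum_i lam 0 i * 2.
Proof.
rewrite kernel_KE (le_trans (ler_norm_sum _ _ _))//; apply: ler_sum => i _.
rewrite !normrM (gtr0_norm (lam_gt0 i)) mulrAC mulrC ler_wpM2l ?(ltW (lam_gt0 i))//.
apply: le_trans (_ : Num.sqrt 2 * Num.sqrt 2 <= 2); last by rewrite -expr2 sqr_sqrtr.
by rewrite ler_pM// normr_feature_le.
Qed.

(** At 0 the sines vanish, but each cosine feature has the value [sqrt 2]. *)
Lemma kernel_K0_gt0 : 0 < kernel_K X freq lam 0 0.
Proof.
rewrite kernel_KE big_split_ord/= ltr_wpDl//.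
  by apply: sumr_ge0 => i _; rewrite mulrAC -expr2 mulr_ge0 ?sqr_ge0// ltW.
have E i : feature X freq 0 (rshift m.+1 i) 0 = Num.sqrt 2.
  by rewrite /feature col_mxEd mxE /phic mulr0 mul0r cos0 mulr1.
rewrite (bigD1 ord0)//= ltr_pwDl//.
  by rewrite !mulr_gt0// E sqrtr_gt0.
by apply: sumr_ge0 => i _; rewrite E !mulr_ge0 ?sqrtr_ge0// ltW.
Qed.

Lemma kernel_sup_gt0 : 0 < X -> 0 < kernel_sup X freq lam.
Proof.
move=> X0.
have X2 : input_space X 0.
  by rewrite /input_space/= in_itv/= mulNr oppr_le0 divr_ge0// ltW.
have K0 : 0 < Num.sqrt `|kernel_K X freq lam 0 0|.
  by rewrite sqrtr_gt0 normr_gt0 gt_eqF// kernel_K0_gt0.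
apply: (lt_le_trans K0); apply: ub_le_sup; last by exists 0 => //; exists 0.
exists (Num.sqrt (\sum_i lam 0 i * 2)) => _ [xa _ [xb _ <-]].
by rewrite ler_wsqrtr// normr_kernel_le.
Qed.

End kernel.

(** * Orthogonality of sines and cosines over the input space *)

Section trigonometric_orthogonality.
Context {R : realType} (X : R).
Hypothesis X_gt0 : 0 < X.
Notation mu := (@lebesgue_measure R).
Notation I := (input_space X).

Lemma integrable_input_space (f : R -> R) : continuous f ->
  mu.-integrable I (EFin \o f).
Proof.
move=> cf; apply: continuous_compact_integrable; first exact: segment_compact.
by apply: continuous_subspaceT => x; exact: cf.
Qed.

Lemma measurable_input_space : measurable (I : set (measurableTypeR R)).
Proof. exact: measurable_itv. Qed.

Lemma Rintegral_input_spaceD (f g : R -> R) : continuous f -> continuous g ->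
  \int[mu]_(x in I) (f x + g x) =
  \int[mu]_(x in I) f x + \int[mu]_(x in I) g x.
Proof.
move=> cf cg; apply: RintegralD; first exact: measurable_input_space.
- exact: integrable_input_space.
- exact: integrable_input_space.
Qed.

Lemma Rintegral_input_spaceZ (a : R) (f : R -> R) : continuous f ->
  \int[mu]_(x in I) (a * f x) = a * \int[mu]_(x in I) f x.
Proof.
move=> cf; apply: RintegralZl; first exact: measurable_input_space.
exact: integrable_input_space.
Qed.

(** A cosine with an arbitrary phase covers [phic] (phase 0) and [phis] (phase
    [- (pi / 2)]) at once, and the class of such functions is closed under
    shifts and, up to sums, products.  The frequency is real, to allow
    differences of natural numbers. *)
Definition wave (w th x : R) : R := cos (2 * pi * w * x / X + th).

Lemma is_derive_phase (w th x : R) :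
  is_derive x 1 (fun x => 2 * pi * w * x / X + th) (2 * pi * w / X).
Proof.
have -> : (fun x => 2 * pi * w * x / X + th) =
    ((2 * pi * w / X) *: (id : R -> R)) + cst th.
  by apply/funext => y; rewrite /= mulrAC.
by apply: is_derive_eq; rewrite addr0 /GRing.scale/= mulr1.
Qed.

Lemma continuous_wave (w th : R) : continuous (wave w th).
Proof.
move=> x; apply: differentiable_continuous.
exact/derivable1_diffP/ex_derive.
Qed.

Lemma Rintegral_wave_const (th : R) :
  \int[mu]_(x in I) wave 0 th x = X * cos th.
Proof.
under eq_Rintegral do rewrite /wave mulr0 !mul0r add0r.
rewrite Rintegral_cst; last exact: measurable_input_space.
have muI : fine (mu I) = X.
  rewrite /input_space lebesgue_measure_itv/= lte_fin input_space_lt//=.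
  by field.
by rewrite mulrC; congr (_ * _); exact: muI.
Qed.

(** The assumption [sin (pi * w) = 0] expresses that [w] is an integer: the
    antiderivative, a sine, then takes the same value at both ends of the
    period. *)
Lemma Rintegral_wave (w th : R) : w != 0 -> sin (pi * w) = 0 ->
  \int[mu]_(x in I) wave w th x = 0.
Proof.
move=> w0 sw.
pose c := 2 * pi * w / X.
have c0 : c != 0.
  by rewrite /c !mulf_neq0 ?invr_neq0 ?pnatr_eq0 ?(gt_eqF (pi_gt0 R)) ?(gt_eqF X_gt0).
pose F (x : R) := c^-1 *: sin (2 * pi * w * x / X + th).
have dF (x : R) : is_derive x 1 F (wave w th x).
  have := @is_derive1_comp _ _ _ x _ _ (is_derive_sin _) (is_derive_phase w th x).
  move=> /(is_deriveZ c^-1) h; apply: is_derive_eq h _.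
  by rewrite /wave /GRing.scale/= -/c mulrCA mulVf ?mulr1.
have cF : continuous F.
  by move=> x; apply/differentiable_continuous/derivable1_diffP/ex_derive.
rewrite /Rintegral (@continuous_FTC2 _ _ F _ _ (input_space_lt X_gt0)).
- rewrite /= /F.
  have -> : 2 * pi * w * (X / 2) / X + th = pi * w + th.
    by field; rewrite gt_eqF.
  have -> : 2 * pi * w * (- X / 2) / X + th = - (pi * w) + th.
    by field; rewrite gt_eqF.
  by rewrite !sinD cosN sinN sw oppr0 !mul0r !add0r subrr.
- by apply: continuous_subspaceT => x; exact: continuous_wave.
- split.
  + by move=> x _; apply: ex_derive.
  + exact/cvg_at_right_filter/cF.
  + exact/cvg_at_left_filter/cF.
- by move=> x _; rewrite derive1E; apply: derive_val.
Qed.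

Lemma sin_pi_natmul (n : nat) : sin (pi * n%:R) = 0 :> R.
Proof.
elim: n => [|n IH]; first by rewrite mulr0 sin0.
by rewrite -natr1 mulrDr mulr1 sinD IH sinpi mul0r mulr0 addr0.
Qed.

(** The product is half the sum of the waves of frequencies [p - q] and [p + q],
    and only a wave of frequency 0 can have a nonzero integral. *)
Lemma Rintegral_waveM (p q : nat) (a b : R) : (0 < p)%N -> (0 < q)%N ->
  \int[mu]_(x in I) (wave p%:R a x * wave q%:R b x) =
  (p == q)%:R * (X / 2 * cos (a - b)).
Proof.
move=> p0 q0.
have E x : wave p%:R a x * wave q%:R b x =
    2^-1 * wave (p%:R - q%:R) (a - b) x + 2^-1 * wave (p%:R + q%:R) (a + b) x.
  rewrite /wave; set u := _ * p%:R * _ / _ + a; set v := _ * q%:R * _ / _ + b.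
  have -> : 2 * pi * (p%:R - q%:R) * x / X + (a - b) = u - v.
    by rewrite /u /v; ring.
  have -> : 2 * pi * (p%:R + q%:R) * x / X + (a + b) = u + v.
    by rewrite /u /v; ring.
  by move: u v => u v; rewrite cosB cosD; field.
have cw (r th : R) : continuous (fun x => 2^-1 * wave r th x).
  by move=> x; apply: cvgM; [exact: cvg_cst|exact: continuous_wave].
under eq_Rintegral do rewrite E.
rewrite Rintegral_input_spaceD// !Rintegral_input_spaceZ; try exact: continuous_wave.
rewrite [X in _ + _ * X]Rintegral_wave; last 2 first.
- by rewrite -natrD pnatr_eq0 -lt0n addn_gt0 p0.
- by rewrite -natrD sin_pi_natmul.
rewrite mulr0 addr0; have [->|pq] := eqVneq p q.
  by rewrite subrr Rintegral_wave_const mul1r mulrA (mulrC _ X).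
rewrite mul0r Rintegral_wave ?mulr0//.
- by rewrite subr_eq0 eqr_nat.
- by rewrite mulrBr sinB !sin_pi_natmul mul0r mulr0 subrr.
Qed.


Lemma phisE (q : nat) (x : R) :
  phis X q x = Num.sqrt 2 * wave q%:R (- (pi / 2)) x.
Proof. by rewrite /phis /wave cosBpihalf. Qed.

Lemma phicE (q : nat) (x : R) : phic X q x = Num.sqrt 2 * wave q%:R 0 x.
Proof. by rewrite /phic /wave addr0. Qed.

Lemma continuous_scale_fun (a : R) (f : R -> R) :
  continuous f -> continuous (fun x => a * f x).
Proof. by move=> cf x; apply: cvgM; [exact: cvg_cst|exact: cf]. Qed.

Lemma continuous_mul_fun (f g : R -> R) :
  continuous f -> continuous g -> continuous (fun x => f x * g x).
Proof. by move=> cf cg x; apply: cvgM; [exact: cf|exact: cg]. Qed.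


Lemma continuous_add_fun (f g : R -> R) :
  continuous f -> continuous g -> continuous (fun x => f x + g x).
Proof. by move=> cf cg x; apply: cvgD; [exact: cf|exact: cg]. Qed.

Lemma trig_sumS (als alc : nat -> R) (n : nat) : (0 < n)%N ->
  trig_sum X als alc n.+1 = (fun x => trig_sum X als alc n x +
   (als n * Num.sqrt 2 * wave n%:R (- (pi / 2)) x +
    alc n * Num.sqrt 2 * wave n%:R 0 x)).
Proof.
move=> n0; apply/funext => x.
by rewrite /trig_sum big_nat_recr//= phisE phicE !mulrA.
Qed.

Lemma trig_sum1 (als alc : nat -> R) : trig_sum X als alc 1 = cst 0.
Proof. by apply/funext => x; rewrite /trig_sum big_geq. Qed.

Lemma continuous_trig_sum (als alc : nat -> R) (n : nat) : (0 < n)%N ->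
  continuous (trig_sum X als alc n).
Proof.
elim: n => // -[_ _|n IH _].
  by rewrite trig_sum1 => x; exact: cvg_cst.
rewrite trig_sumS//; apply: continuous_add_fun; first exact: IH.
by apply: continuous_add_fun; apply: continuous_scale_fun; exact: continuous_wave.
Qed.

(** By orthogonality only frequency [q] contributes.  The phase [th] selects the
    coefficient: the right-hand side reduces to that of the sine for
    [th = - (pi / 2)] and to that of the cosine for [th = 0]. *)
Lemma Rintegral_trig_sum_wave (als alc : nat -> R) (n q : nat) (th : R) :
  (0 < n)%N -> (0 < q)%N ->
  \int[mu]_(x in I) (trig_sum X als alc n x * wave q%:R th x) =
  (q < n)%:R * (X / 2 * Num.sqrt 2 *
    (als q * cos (- (pi / 2) - th) + alc q * cos (0 - th))).
Proof.
elim: n => // -[_ _ q0|n IH _ q0].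
  rewrite trig_sum1 ltnS leqn0 (gtn_eqF q0) mul0r.
  under eq_Rintegral do rewrite /= mul0r.
  by rewrite Rintegral_cst ?mul0r//; exact: measurable_input_space.
have cw r e : continuous (wave r e) := @continuous_wave r e.
rewrite trig_sumS//.
pose S := trig_sum X als alc n.+1.
rewrite (_ : (fun x => _) = (fun x => S x * wave q%:R th x +
    (als n.+1 * Num.sqrt 2 * (wave n.+1%:R (- (pi / 2)) x * wave q%:R th x) +
     alc n.+1 * Num.sqrt 2 * (wave n.+1%:R 0 x * wave q%:R th x)))); last first.
  by apply/funext => x; rewrite -/S; ring.
have cS : continuous S by exact: continuous_trig_sum.
have cW e : continuous (fun x => wave n.+1%:R e x * wave q%:R th x).
  exact: continuous_mul_fun.
rewrite Rintegral_input_spaceD; last 2 first.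
- exact: continuous_mul_fun.
- by apply: continuous_add_fun; apply: continuous_scale_fun; exact: cW.
rewrite Rintegral_input_spaceD; last 2 first.
- by apply: continuous_scale_fun; exact: cW.
- by apply: continuous_scale_fun; exact: cW.
rewrite !Rintegral_input_spaceZ// IH// !Rintegral_waveM//.
rewrite [in RHS]ltnS [in RHS]leq_eqVlt.
have [->|] := eqVneq q n.+1; last by rewrite /= !mul0r !mulr0 !addr0.
by rewrite ltnn mul0r add0r !mul1r/=; ring.
Qed.

(** Bessel's inequality for one coefficient [a]: with [e] the normalized wave,
    integrate [2 * a * S * e - a ^+ 2 * e ^+ 2 <= S ^+ 2], which says that
    [(S - a * e) ^+ 2] is nonnegative. *)
Lemma sqr_le_Rintegral_trig_sum (als alc : nat -> R) (n q : nat) (th a : R) :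
  (0 < q)%N -> (q < n)%N ->
  a = als q * cos (- (pi / 2) - th) + alc q * cos (0 - th) ->
  a ^+ 2 * X <= \int[mu]_(x in I) (trig_sum X als alc n x ^+ 2).
Proof.
move=> q0 qn aE.
have n0 : (0 < n)%N by exact: leq_ltn_trans qn.
set S := trig_sum X als alc n.
have cS : continuous S by exact: continuous_trig_sum.
have cw r e : continuous (wave r e) := @continuous_wave r e.
pose f x := 2 * a * Num.sqrt 2 * (S x * wave q%:R th x).
pose g x := - 2 * a ^+ 2 * (wave q%:R th x * wave q%:R th x).
have cf : continuous f by apply/continuous_scale_fun/continuous_mul_fun.
have cg : continuous g by apply/continuous_scale_fun/continuous_mul_fun.
have -> : a ^+ 2 * X = \int[mu]_(x in I) (f x + g x).
  rewrite Rintegral_input_spaceD// !Rintegral_input_spaceZ; try exact: continuous_mul_fun.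
  rewrite Rintegral_trig_sum_wave// -aE Rintegral_waveM// qn eqxx subrr cos0 !mul1r.
  have : Num.sqrt 2 * Num.sqrt 2 = 2 :> R by rewrite -expr2 sqr_sqrtr.
  move: (Num.sqrt 2) => r rr.
  transitivity (a ^+ 2 * X * (r * r) - a ^+ 2 * X); last by field.
  by rewrite rr; ring.
apply: le_Rintegral; first exact: measurable_input_space.
- by apply: integrable_input_space; exact: continuous_add_fun.
- by apply: integrable_input_space; apply: continuous_mul_fun.
move=> x _; rewrite -subr_ge0 /f /g.
rewrite (_ : _ - _ = (S x - a * (Num.sqrt 2 * wave q%:R th x)) ^+ 2) ?sqr_ge0//.
have : 2 = Num.sqrt 2 * Num.sqrt 2 :> R by rewrite -expr2 sqr_sqrtr.
move: (Num.sqrt 2) (wave _ _ _) (S x) => r w s rr.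
transitivity (s ^+ 2 - 2 * a * r * (s * w) + 2 * a ^+ 2 * w ^+ 2); first by ring.
by rewrite [in X in _ + X]rr; ring.
Qed.

End trigonometric_orthogonality.

(** * The coefficients are bounded by the L2 norm *)

Section regression_bound.
Context {R : realType} (X : R) (X0 : 0 < X).
Notation mu := (@lebesgue_measure R).
Notation TR := (measurableTypeR R).

Lemma le_Lnorm2_rhoX (S : R -> R) (a : R) : continuous S ->
  a ^+ 2 * X <= \int[mu]_(x in input_space X) (S x ^+ 2) ->
  (`|a|%:E <= 'N[rhoX X0]_2%:E[EFin \o (S : TR -> R)])%E.
Proof.
move=> cS aS.
have cS2 : continuous (fun x => S x ^+ 2) by exact: continuous_mul_fun.
have mS2 : measurable_fun [set: TR] (fun x => S x ^+ 2).
  exact: continuous_measurable_fun.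
rewrite unlock /Lnorm.
have -> : (\int[rhoX X0]_x `|(EFin \o (S : TR -> R)) x| `^ 2 =
    \int[rhoX X0]_x (S x ^+ 2)%:E)%E.
  apply: eq_integral => x _ /=.
  by rewrite powR_mulrn// real_normK// num_real.
rewrite integral_uniform; last 2 first.
- exact/measurable_EFinP.
- by move=> x; rewrite lee_fin sqr_ge0.
have -> : (\int[mu]_(x in `[(- X / 2)%R, (X / 2)%R]) (S x ^+ 2)%:E =
    (\int[mu]_(x in input_space X) (S x ^+ 2))%:E)%E.
  rewrite /Rintegral fineK//; apply: integrable_fin_num.
    exact: measurable_itv.
  exact: integrable_input_space.
have -> : X / 2 - - X / 2 = X by field.
rewrite -EFinM poweR_EFin lee_fin -sqrtr_sqr.
set c := X^-1 * _.
have ac : a ^+ 2 <= c by rewrite /c ler_pdivlMl// mulrC.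
have c0 : 0 <= c by rewrite (le_trans _ ac)// sqr_ge0.
by rewrite powR12_sqrt// ler_wsqrtr.
Qed.


(** Once [n] exceeds [q], the coefficient is at most the norm of the [n]-th
    partial sum by Bessel's inequality, hence at most [B] plus the norm of the
    remainder by Minkowski's inequality, and the remainder tends to 0. *)
Lemma normr_coef_le_Lnorm2 (als alc : nat -> R) (f : TR -> R) (B : R) :
  measurable_fun [set: TR] f -> trig_expansion X0 als alc f ->
  ('N[rhoX X0]_2%:E[EFin \o f] <= B%:E)%E ->
  forall q, (0 < q)%N -> `|als q| <= B /\ `|alc q| <= B.
Proof.
move=> mf fE fB q q0.
suff coef th a : a = als q * cos (- (pi / 2) - th) + alc q * cos (0 - th) ->
    `|a| <= B.
  split.
  - apply: (coef (- (pi / 2))).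
    by rewrite subrr cos0 sub0r opprK cos_pihalf mulr1 mulr0 addr0.
  - apply: (coef 0).
    by rewrite !subr0 cos0 cosN cos_pihalf mulr1 mulr0 add0r.
move=> aE; rewrite -subr_le0 -lee_fin.
apply: (cvge_to_ge fE); exists q.+1 => // n /= qn.
set S := trig_sum X als alc n.
have n0 : (0 < n)%N by exact: leq_ltn_trans qn.
have cS : continuous S by exact: continuous_trig_sum.
have mS : measurable_fun [set: TR] (S : TR -> R).
  exact: continuous_measurable_fun.
rewrite EFinB leeBlDl//.
have aS : (`|a|%:E <= 'N[rhoX X0]_2%:E[EFin \o (S : TR -> R)])%E.
  apply: le_Lnorm2_rhoX => //.
  exact: (@sqr_le_Rintegral_trig_sum R X X0 als alc n q th a).
apply: (le_trans aS).
pose D : TR -> R := \- (fun x => f x - S x).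
have SfD : (S : TR -> R) = (f \+ D).
  by apply/funext => x; rewrite /D /= opprB addrC subrK.
rewrite [in leLHS]SfD; apply: (le_trans (minkowski_EFin _ _ _ _)) => //.
- by apply: measurableT_comp => //; exact: measurable_funB.
- by rewrite ler1n.
apply: leeD => //.
by rewrite -[leRHS]oppe_Lnorm.
Qed.

End regression_bound.

(** * The unique minimizers of the estimated errors *)

Theorem proposition2 (R : realType) (X : R) (X0 : 0 < X)
    (rho : probability (measurableTypeR R * measurableTypeR R)%type R)
    (k : R.-pker (measurableTypeR R) ~> (measurableTypeR R))
    (Bf Bs : R)
    (hmarg : has_input_marginal rho (rhoX X0))
    (hcond : has_conditional rho (rhoX X0) k)
    (hL2 : regression k \in Lfun (rhoX X0) 2%:E)
    (hBf : ('N[rhoX X0]_2%:E[EFin \o regression k] <= Bf%:E)%E)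
    (hBs : (\int[rho]_u ((u.2 - regression k u.1) ^+ 2)%:E <= (Bs ^+ 2)%:E)%E)
    (d : measure_display) (Omega : measurableType d) (P : probability Omega R)
    (N : nat) (N0 : (0 < N)%N)
    (z : 'I_N -> {RV P >-> (measurableTypeR R * measurableTypeR R)%type})
    (hz : iid_samples rho z)
    (delta : R) (hdelta : 0 < delta < 1)
    (als alc : nat -> R)
    (hals : square_summable als) (halc : square_summable alc)
    (hexp : trig_expansion X0 als alc (regression k))
    (m : nat) (freq : 'I_m.+1 -> nat)
    (hfreq : injective freq) (hfreq0 : forall j, (0 < freq j)%N)
    (lam : 'rV[R]_(m.+1 + m.+1)) (hlam : forall i, 0 < lam 0 i)
    (halpha : alpha_pi freq als alc != 0) :
  (Num.sqrt (N%:R * delta) >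
     kernel_sup X freq lam ^+ 3 / lam_min lam `^ (3 / 2) *
     Num.sqrt ((Bf ^+ 2 + Bs ^+ 2) /
               \sum_(i < m.+1 + m.+1) alpha_pi freq als alc i 0 ^+ 2) ->
   exists! gamma : R,
     minimizes_over_pos (F_a X freq lam als alc Bf Bs N delta) gamma)
  /\
  (exists! gamma : R,
     minimizes_over_pos (F_b X freq lam als alc Bf Bs N delta) gamma).
Proof.
have /andP[delta0 _] := hdelta.
have mreg : measurable_fun [set: measurableTypeR R] (regression k).
  by move: hL2 => /sub_Lfun_mfun; rewrite inE.
have [i ai0] : exists i, alpha_pi freq als alc i 0 != 0.
  apply/existsP; apply: contra_neqT halpha => /existsPn a0.
  by apply/matrixP => i j; rewrite ord1 [RHS]mxE; apply/eqP/negbNE/a0.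
have Bf0 : 0 < Bf.
  have aB : `|alpha_pi freq als alc i 0| <= Bf.
    rewrite /alpha_pi mxE; case: splitP => j _; rewrite mxE.
      exact: (normr_coef_le_Lnorm2 mreg hexp hBf (hfreq0 j)).1.
    exact: (normr_coef_le_Lnorm2 mreg hexp hBf (hfreq0 j)).2.
  by apply: lt_le_trans aB; rewrite normr_gt0.
set l := lam_min lam; have l0 : 0 < l by exact: lam_min_gt0.
set K := kernel_sup X freq lam ^+ 3.
have K0 : 0 < K by rewrite exprn_gt0// kernel_sup_gt0.
set B := Bf ^+ 2 + Bs ^+ 2.
have B0 : 0 < B by rewrite ltr_pwDl ?sqr_ge0// exprn_gt0.
set A := K * Num.sqrt (B / (l * N%:R * delta)).
have Nd0 : 0 < N%:R * delta by rewrite mulr_gt0// ltr0n.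
have A0 : 0 < A.
  by rewrite mulr_gt0// sqrtr_gt0 divr_gt0// -mulrA mulr_gt0.
have sampleE g : sample_error_bound X freq lam Bf Bs N delta g = A / g.
  by rewrite /sample_error_bound -/l -/B -/K mulrAC.
split.
- set S := \sum_(i < _) _ => hN.
  have S0 : 0 < S.
    rewrite /S (bigD1 i)//= ltr_pwDl ?exprn_even_gt0//.
    by apply: sumr_ge0 => j _; rewrite sqr_ge0.
  set n := norm2 (alpha_pi freq als alc).
  have -> : F_a X freq lam als alc Bf Bs N delta =
      (fun g => A / g + (g / (l + g) * n + Num.sqrt (tail_sum freq als alc))).
    by apply/funext => g; rewrite /F_a sampleE.
  apply: unique_minimizer_inv_plus_saturating => //; rewrite A0/=.
  by rewrite /A -mulrA; apply: sample_constant_lt.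
- set M := mx_norm (alpha_pi freq als alc) * (\sum_(i < _) (lam 0 i)^-1).
  have -> : F_b X freq lam als alc Bf Bs N delta =
      (fun g => A / g + (M * g + Num.sqrt (tail_sum freq als alc))).
    apply/funext => g; rewrite /F_b sampleE /approx_error_bound_b.
    by rewrite (mulrAC _ g).
  apply: unique_minimizer_inv_plus_linear => //.
  rewrite mulr_gt0//; first by have := halpha; rewrite -normr_gt0.
  rewrite (bigD1 ord0)//= ltr_pwDl ?invr_gt0//.
  by apply: sumr_ge0 => j _; rewrite invr_ge0 ltW.
Qed.
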